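(* Fix $\epsilon>0$ arbitrary. (i) For each $l=0,2,3,4,\dots$, the equation $\lambda^2+\hat r_lG_l(\epsilon\lambda)=0$ has $l+2$ solutions, denoted $\lambda_{l,j}(\epsilon)$, $j=1,\dots,l+2$ (the deformation resonance energies). (ii) The set $\{\lambda_{l,j}(\epsilon)\}$ is symmetric about the imaginary axis (i.e. if $\lambda$ is a solution then so is $-\overline{\lambda}$), and every solution satisfies $\operatorname{Im}\lambda_{l,j}<0$.
   Context: Parameters $\mathrm{Ca}>0$, $\mathrm{We}>0$, $\gamma>1$. $h_l^{(1)}$ is the outgoing spherical Hankel function of order $l$ and $G_l(z)=z\,\partial h_l^{(1)}(z)/h_l^{(1)}(z)$. $\hat r_0=\frac{3\gamma}{2}\mathrm{Ca}+2(3\gamma-1)\frac{1}{\mathrm{We}}$ and $\hat r_l=\frac{1}{\mathrm{We}}(l+2)(l-1)$ for $l\ge1$. *)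

(* Defs.v *)
From HB Require Import structures.
From mathcomp Require Import all_boot all_order all_algebra.
From mathcomp Require Import all_classical all_reals all_analysis.
From mathcomp Require Import complex.
Import Order.TTheory GRing.Theory Num.Theory numFieldNormedType.Exports.
Set Implicit Arguments.
Unset Strict Implicit.
Unset Printing Implicit Defensive.
Local Open Scope ring_scope.

(* The complex numbers over a real type R, seen as a numClosedFieldType, so that
   mathcomp-analysis' normed-module structure (over itself) applies: derive1 on
   Cplx R -> Cplx R is the complex derivative. *)
Definition Cplx (R : realType) : numClosedFieldType := R[i].

Definition expC (R : realType) (z : Cplx R) : Cplx R :=
  ((expR (complex.Re z))%:C * ((cos (complex.Im z)) +i* (sin (complex.Im z))))%C.

(* Outgoing spherical Hankel function of order l (closed form):
   h_l^(1)(z) = (-i)^(l+1) e^{iz}/z * sum_{k=0}^l (l+k)!/(k!(l-k)!) (i/(2z))^k *)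
Definition hankel1 (R : realType) (l : nat) (z : Cplx R) : Cplx R :=
  (- 'i) ^+ l.+1 * expC ('i * z) / z *
  \sum_(k < l.+1) (((l + k)`!)%:R / ((k`! * (l - k)`!)%:R) * ('i / (2%:R * z)) ^+ k).

Definition G_l (R : realType) (l : nat) (z : Cplx R) : Cplx R :=
  z * derive1 (hankel1 l) z / hankel1 l z.

Definition rhat (R : realType) (Ca We gamma : R) (l : nat) : R :=
  if l == 0%N then 3%:R * gamma / 2%:R * Ca + 2%:R * (3%:R * gamma - 1) / We
  else ((l + 2) * (l - 1))%:R / We.

(* Main.v *)
(* In the variable w = -i eps lambda one has h_l^(1) ~ e^{-w} w^{-l-1} theta_l(w)
   with theta_l the reverse Bessel polynomial, whence
   G_l = - (l+1) - w rho_l(w) / theta_l(w) with rho_l = theta_l - theta_l'.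
   So F(lambda) = - eps^-2 P(w) / theta_l(w), where
   P = X^2 theta_l + c ((l+1) theta_l + X rho_l) and c = rhat_l eps^2, a monic real
   polynomial of degree l+2; its roots avoid 0 and the zeros of theta_l because
   theta_l and rho_l are coprime.  Im lambda < 0 means Re w < 0: the quotients
   s_l = rho_l / theta_l satisfy s_0 = 1 and s_(l+1) = 1 / ((2l+1)/w + s_l), so that
   Re s_l > 0 when Re w >= 0, w <> 0, and then
   P(w) / (w theta_l(w)) = w + c (l+1)/w + c s_l also has positive real part. *)
Require Import Defs.
From HB Require Import structures.
From mathcomp Require Import all_boot all_order all_algebra.
From mathcomp Require Import all_classical all_reals all_analysis.
From mathcomp Require Import complex ring lra zify.
Import Order.TTheory GRing.Theory Num.Theory numFieldNormedType.Exports.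
Local Open Scope classical_set_scope.
Local Open Scope ring_scope.

(** * Reverse Bessel polynomials *)

(* The reverse Bessel polynomial theta_n, paired with rho_n = X theta_(n-1); the
   convention rho_0 = 1 is what makes rho_n = theta_n - theta_n' hold at n = 0. *)
Fixpoint bessel_pair (F : comNzRingType) (n : nat) : {poly F} * {poly F} :=
  if n is m.+1 then
    let: (p, q) := bessel_pair F m in ((2 * m + 1)%:R *: p + 'X * q, 'X * p)
  else (1, 1).

Definition bessel (F : comNzRingType) n : {poly F} := (bessel_pair F n).1.
Definition cobessel (F : comNzRingType) n : {poly F} := (bessel_pair F n).2.

Section Bessel.
Variable F : comNzRingType.
Local Notation theta := (bessel F).
Local Notation rho := (cobessel F).

Lemma bessel0 : theta 0 = 1. Proof. by []. Qed.
Lemma cobessel0 : rho 0 = 1. Proof. by []. Qed.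

Lemma besselS n : theta n.+1 = (2 * n + 1)%:R *: theta n + 'X * rho n.
Proof. by rewrite /bessel /cobessel /=; case: (bessel_pair F n). Qed.

Lemma cobesselS n : rho n.+1 = 'X * theta n.
Proof. by rewrite /bessel /cobessel /=; case: (bessel_pair F n). Qed.

Lemma deriv_bessel n : (theta n)^`() = theta n - rho n.
Proof.
(* The derivative of [rho] enters on passing from n to n+1, so a second identity is carried along;
   its factor X avoids a division. *)
suff [] : (theta n)^`() = theta n - rho n /\
  'X * (rho n)^`() = (2 * n)%:R *: rho n + 'X * rho n - 'X * theta n by [].
elim: n => [|n [IHt IHr]].
  by rewrite bessel0 cobessel0 -polyC1 derivC muln0 scale0r; split; ring.
rewrite besselS cobesselS !poly.derivE IHt IHr -!mul_polyC !polyC_natr.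
split; last ring.
by rewrite natrD; ring.
Qed.

Lemma bessel_cobessel_monic n :
  [/\ theta n \is monic, size (theta n) = n.+1,
      rho n \is monic & size (rho n) = n.+1].
Proof.
elim: n => [|n [mt st mr sr]].
  by rewrite bessel0 cobessel0 !monic1 !size_poly1.
have sXr : size ('X * rho n) = n.+2.
  by rewrite mulrC size_mulX ?sr// monic_neq0.
have mXr : 'X * rho n \is monic by rewrite monicMl ?monicX.
have lt : (size ((2 * n + 1)%:R *: theta n) < size ('X * rho n)%R)%N.
  by rewrite sXr ltnS -st size_scale_leq.
rewrite besselS cobesselS addrC; split.
- by apply/monicP; rewrite lead_coefDl// (monicP mXr).
- by rewrite size_polyDl.
- by rewrite monicMl ?monicX.
- by rewrite mulrC size_mulX ?st// monic_neq0.
Qed.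

Lemma bessel_monic n : theta n \is monic.
Proof. by case: (bessel_cobessel_monic n). Qed.

Lemma size_bessel n : size (theta n) = n.+1.
Proof. by case: (bessel_cobessel_monic n). Qed.

Lemma size_cobessel n : size (rho n) = n.+1.
Proof. by case: (bessel_cobessel_monic n). Qed.

End Bessel.

Lemma map_bessel (F K : comNzRingType) (f : {rmorphism F -> K}) n :
  map_poly f (bessel F n) = bessel K n /\
  map_poly f (cobessel F n) = cobessel K n.
Proof.
elim: n => [|n [IHt IHr]]; first by rewrite /bessel /cobessel /= rmorph1.
rewrite !besselS !cobesselS rmorphD !rmorphM /= linearZ /= map_polyX.
by rewrite IHt IHr rmorph_nat.
Qed.

(** The constant term is the double factorial (2n-1)!!, nonzero in characteristic 0. *)
Lemma bessel_nonroot0 (F : numDomainType) n : (bessel F n).[0] != 0.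
Proof.
elim: n => [|n IH]; first by rewrite bessel0 hornerC oner_neq0.
by rewrite besselS !hornerE mulf_neq0// pnatr_eq0 addn1.
Qed.

(** A common zero w would descend: rho_(n+1) = X theta_n forces theta_n(w) = 0, the recurrence then
    forces rho_n(w) = 0, and theta_0 = 1 ends the descent. *)
Lemma bessel_cobessel_coprime (F : idomainType) n (w : F) :
  w != 0 -> (bessel F n).[w] = 0 -> (cobessel F n).[w] != 0.
Proof.
move=> w0; elim: n => [|n IH].
  by rewrite bessel0 hornerC => /eqP; rewrite oner_eq0.
rewrite besselS cobesselS !hornerE => tS; rewrite mulf_neq0//.
apply/eqP => t0; move/eqP: tS; rewrite t0 mulr0 add0r mulf_eq0 (negPf w0) /=.
by apply/negP; exact: IH.
Qed.

(* The guard is needed since n - k is truncated. *)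
Definition bessel_coef (F : fieldType) (n k : nat) : F :=
  if (k <= n)%N then ((n + k)`!)%:R / ((k`! * (n - k)`!)%:R) else 0.

(** This is theta_(n+2) = (2n+3) theta_(n+1) + X^2 theta_n divided by w^(n+2) and read on the powers
    of t = 1/(2w), whence the extra factor 2. *)
Lemma bessel_coefSS (F : numFieldType) n k :
  bessel_coef F n.+2 k.+1 =
  (2 * (2 * n.+1 + 1))%:R * bessel_coef F n.+1 k + bessel_coef F n k.+1.
Proof.
have nf m : (m`!)%:R != 0 :> F by rewrite pnatr_eq0 -lt0n fact_gt0.
have np m : m.+1%:R != 0 :> F by rewrite pnatr_eq0.
rewrite /bessel_coef ltnS; case: (leqP k n.+1) => [|kn]; last first.
  rewrite ifF; last by apply/negbTE; lia.
  by rewrite mulr0 addr0.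
(* For k = n+1 and k = n the guard makes the last coefficient 0, so these cases are split off. *)
rewrite leq_eqVlt => /orP[/eqP ->|]; last rewrite ltnS leq_eqVlt => /orP[/eqP->|].
- rewrite ifF; last by apply/negbTE; lia.
  rewrite addr0 !subnn !muln1.
  have [m mE] : exists m, m = (n.+1 + n.+1)%N by exists (n.+1 + n.+1)%N.
  rewrite (_ : (n.+2 + n.+2 = m.+2)%N) -?mE; last lia.
  rewrite (factS m.+1) (factS m) (factS n.+1) (factS n) !natrM.
  move: (nf m) (nf n) (np n) (np n.+1); move: (m`!%:R) (n`!%:R) => a b a0 b0 n0 n1.
  rewrite mE; field.
  by rewrite ?b0 ?nat1r -?natrD ?np.
- rewrite ltnn addr0.
  have -> : (n.+2 - n.+1 = 1)%N by lia.
  have -> : (n.+1 - n = 1)%N by lia.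
  rewrite (factS 0) fact0 !muln1.
  have [m mE] : exists m, m = (n.+1 + n)%N by exists (n.+1 + n)%N.
  rewrite (_ : (n.+2 + n.+1 = m.+2)%N) -?mE; last lia.
  rewrite (factS m.+1) (factS m) (factS n) !natrM.
  move: (nf m) (nf n) (np n); move: (m`!%:R) (n`!%:R) => a b a0 b0 n0.
  rewrite mE; field.
  by rewrite ?b0 ?nat1r -?natrD ?np.
move=> kn; rewrite kn.
(* With n = k+1+d and m = n+k+1 every factorial is a shift of m!, k! or d!, and no truncated
   subtraction remains. *)
have [d dE] : exists d, (n = k.+1 + d)%N by exists (n - k.+1)%N; lia.
have [m mE] : exists m, m = (n + k.+1)%N by exists (n + k.+1)%N.
have -> : (n.+2 - k.+1 = d.+2)%N by lia.
have -> : (n.+1 - k = d.+2)%N by lia.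
have -> : (n - k.+1 = d)%N by lia.
have -> : (n.+2 + k.+1 = m.+2)%N by lia.
have -> : (n.+1 + k = m)%N by lia.
rewrite -mE (factS m.+1) (factS m) (factS k) (factS d.+1) (factS d) !natrM.
move: (nf m) (nf k) (nf d) (np k) (np d) (np d.+1).
move: (m`!%:R) (k`!%:R) (d`!%:R) => a b c a0 b0 c0 k0 d0 d1.
rewrite mE dE; field.
by rewrite ?b0 ?c0 ?nat1r -?natrD ?np.
Qed.

Lemma bessel_coef0 (F : numFieldType) n : bessel_coef F n 0 = 1.
Proof.
by rewrite /bessel_coef addn0 subn0 fact0 mul1n divff// pnatr_eq0 -lt0n fact_gt0.
Qed.

Lemma sum_bessel_coefSS (F : numFieldType) n (t : F) :
  \sum_(k < n.+3) bessel_coef F n.+2 k * t ^+ k =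
  (2 * (2 * n.+1 + 1))%:R * t * (\sum_(k < n.+2) bessel_coef F n.+1 k * t ^+ k) +
  \sum_(k < n.+1) bessel_coef F n k * t ^+ k.
Proof.
pose p m : {poly F} := \poly_(k < m.+1) bessel_coef F m k.
have pE m : \sum_(k < m.+1) bessel_coef F m k * t ^+ k = (p m).[t].
  by rewrite horner_poly.
have coefp m k : (p m)`_k = bessel_coef F m k.
  by rewrite coef_poly ltnS; case: ifP => //; rewrite /bessel_coef => ->.
suff -> : \sum_(k < n.+3) bessel_coef F n.+2 k * t ^+ k =
    ((2 * (2 * n.+1 + 1))%:R *: ('X * p n.+1) + p n).[t].
  by rewrite !pE hornerD hornerZ hornerM hornerX mulrA.
rewrite pE; congr (_.[t]); apply/polyP => -[|k].
  by rewrite coefD coefZ coefXM !coefp !bessel_coef0 mulr0 add0r.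
by rewrite coefD coefZ coefXM !coefp bessel_coefSS.
Qed.

Lemma horner_bessel (F : numFieldType) n (w : F) : w != 0 ->
  (bessel F n).[w] = w ^+ n * \sum_(k < n.+1) bessel_coef F n k * (2 * w)^-1 ^+ k.
Proof.
move=> w0; set S := fun m => \sum_(k < m.+1) bessel_coef F m k * (2 * w)^-1 ^+ k.
(* Two consecutive indices are needed because the recurrence for [S] has three terms. *)
suff [] : (bessel F n).[w] = w ^+ n * S n /\
  (bessel F n.+1).[w] = w ^+ n.+1 * S n.+1 by [].
elim: n => [|n [IH0 IH1]].
  rewrite besselS bessel0 cobessel0 /S !big_ord_recl !big_ord0 !hornerE /=.
  rewrite !bessel_coef0 /bessel_coef /=.
  rewrite (_ : (1 + bump 0 0)`! = 2)%N //.
  rewrite (_ : (bump 0 0)`! * (1 - bump 0 0)`! = 1)%N //.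
  rewrite divr1 addr0 expr1; split=> //.
  by rewrite /bump /= expr1; field.
split=> //; rewrite besselS cobesselS hornerD hornerZ !hornerM hornerX.
rewrite IH0 IH1 {3}/S sum_bessel_coefSS.
rewrite !exprS -/(S n) -/(S n.+1) natrM; move: (2 * n.+1 + 1)%N => m.
by field.
Qed.

(** * Complex derivatives and the complex exponential *)

Lemma is_derive_linear_approx (R : realType) (f : R -> R) (x l : R) :
  is_derive x 1 f l -> forall r, 0 < r -> exists2 d, 0 < d &
    forall h, `|h| < d -> `|f (x + h) - f x - l * h| <= r * `|h|.
Proof.
move=> [+ fl] r r0; rewrite derivable_nbhsP => /eqaddoP /(_ r r0).
rewrite fl => /nbhs_normP[d d0 dP]; exists d => // h hd.
have -> : f (x + h) - f x - l * h = f (h *: 1 + x) - (f x + h *: l).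
  by rewrite opprD addrA [h%:A]mulr1 [_ *: l]mulrC [h + x]addrC.
by apply: dP; rewrite /ball_ /= sub0r normrN.
Qed.

Section NumFieldDerivatives.
Variable K : numFieldType.
Implicit Types (f g : K -> K) (z : K).

Lemma is_derive_normP f z (l : K) :
  (forall e : K, 0 < e -> exists2 d : K, 0 < d & forall h : K,
     h != 0 -> `|h| < d -> `|f (h + z) - f z - l * h| <= e * `|h|) ->
  is_derive z (1 : K) f l.
Proof.
move=> fP.
have cv : (fun h : K => h^-1 *: ((f \o shift z) (h *: 1) - f z))
    @ (0 : K)^' --> (l : K).
  apply/cvgrPdist_le => e /fP[d d0 dP].
  apply/nbhs_normP; exists d => // h; rewrite /ball_ /= sub0r normrN => hd h0.
  rewrite [h *: 1]mulr1.
  have -> : l - h^-1 *: (f (h + z) - f z) = - (h^-1 * (f (h + z) - f z - l * h)).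
    by rewrite /GRing.scale /=; field.
  by rewrite normrN normrM normfV ler_pdivrMl ?normr_gt0// [leRHS]mulrC dP.
by split; [apply/cvg_ex; exists l|exact: cvg_lim cv].
Qed.

Lemma is_derive_comp f g z (a b : K) :
  is_derive (g z) (1 : K) f a -> is_derive z (1 : K) g b ->
  is_derive z (1 : K) (f \o g) (a * b).
Proof.
move=> [/derivable1_diffP df <-] [/derivable1_diffP dg <-].
have dfg : differentiable (f \o g) z by exact: differentiable_comp.
apply: DeriveDef; first exact/derivable1_diffP.
rewrite !deriveE// diff_comp//= -[X in 'd  _ _ X = _]mulr1.
by rewrite [LHS]linearZ mulrC.
Qed.

(** The functional equation writes f x as f z * f (x - z), which transports the derivative at 0 to
    z. *)
Lemma is_derive_exponential f :
  (forall x y, f (x + y) = f x * f y) -> is_derive (0 : K) (1 : K) f 1 ->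
  forall z, is_derive z (1 : K) f (f z).
Proof.
move=> fD f0 z.
have -> : f = (fun x => f z *: (f \o (fun y => y - z)) x).
  by apply/funext => x; rewrite /GRing.scale /= -fD addrC subrK.
have : is_derive z (1 : K) (f \o (fun y => y - z)) (1 * 1).
  apply: is_derive_comp; first by rewrite subrr.
  exact: is_derive_shift.
rewrite mulr1 => d; rewrite -[X in is_derive _ _ _ X]mulr1.
rewrite /= subrr (_ : f z * f 0 * 1 = f z *: 1).
  exact: is_deriveZ.
by rewrite /GRing.scale /= -fD addr0.
Qed.

Lemma is_derive_horner (p : {poly K}) z : is_derive z (1 : K) (horner p) p^`().[z].
Proof.
elim/poly_ind: p => [|p c ih].
  rewrite deriv0 horner0 (_ : horner 0 = cst 0); first exact: is_derive_cst.
  by apply/funext => x; rewrite horner0.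
have -> : horner (p * 'X + c%:P) = horner p * id + cst c.
  by apply/funext => x; rewrite !hornerE.
rewrite !poly.derivE !hornerE.
apply: is_derive_eq; rewrite /GRing.scale /=; ring.
Qed.

Lemma continuous_horner_numField (p : {poly K}) : continuous (horner p).
Proof.
move=> z; apply/differentiable_continuous/derivable1_diffP.
by have [] := is_derive_horner p z.
Qed.

End NumFieldDerivatives.

Section ComplexExponential.
Variable R : realType.
Local Notation C := (Cplx R).

Lemma expC0 : @expC R 0 = 1.
Proof. by rewrite /expC /= expR0 cos0 sin0 mul1r. Qed.

Lemma expCD (z w : C) : expC (z + w) = expC z * expC w.
Proof.
case: z w => [a b] [c d]; rewrite /expC /= expRD cosD sinD.
by apply/eqP; rewrite eq_complex /=; apply/andP; split; apply/eqP; ring.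
Qed.

Lemma expC_neq0 (z : C) : expC z != 0.
Proof.
apply/eqP => z0; have := expCD z (- z).
by rewrite subrr expC0 z0 mul0r => /eqP; rewrite oner_eq0.
Qed.

(** These bounds control the real and imaginary parts of exp(a+ib) - 1 - (a+ib), for the derivative
    of [expC] at 0. *)
Lemma expR_cos_sin_linear_approx (r : R) : 0 < r -> r <= 1 -> exists2 d, 0 < d &
  forall a b : R, `|a| < d -> `|b| < d ->
    `|expR a * cos b - 1 - a| <= r * (`|a| + 3 * `|b|) /\
    `|expR a * sin b - b| <= r * (5 * `|b|).
Proof.
move=> r0 r1.
have [d1 d10 P1] := is_derive_linear_approx R expR 0 _ (is_derive_expR 0) r r0.
have [d2 d20 P2] := is_derive_linear_approx R sin 0 _ (is_derive_sin 0) r r0.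
have [d3 d30 P3] := is_derive_linear_approx R cos 0 _ (is_derive_cos 0) r r0.
(* Keeping [r] in the minimum gives |a| < r <= 1, hence |e^a| <= 3 and |e^a - 1| |b| <= 2 r |b|; the
   constant 5 is 3 + 2. *)
exists (Num.min (Num.min d1 d2) (Num.min d3 r)).
  by rewrite !lt_min d10 d20 d30 r0.
move=> a b; rewrite !lt_min => /andP[/andP[a1 _] /andP[_ ar]].
move=> /andP[/andP[_ b2] /andP[b3 br]].
have {P1} := P1 a a1; rewrite add0r expR0 mul1r => Ea.
have {P2} := P2 b b2; rewrite add0r sin0 cos0 subr0 mul1r => Sb.
have {P3} := P3 b b3; rewrite add0r cos0 sin0 oppr0 mul0r subr0 => Cb.
have nb := normr_ge0 b; have na := normr_ge0 a.
have ra : r * `|a| <= `|a| by rewrite ler_piMl.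
have E1 : `|expR a - 1| <= 2 * `|a|.
  rewrite (_ : expR a - 1 = expR a - 1 - a + a); last ring.
  apply: le_trans (ler_normD _ _) _; lra.
have E3 : `|expR a| <= 3.
  rewrite (_ : expR a = expR a - 1 + 1); last ring.
  apply: le_trans (ler_normD _ _) _; rewrite normr1; lra.
split.
  rewrite (_ : _ - a = expR a - 1 - a + expR a * (cos b - 1)); last ring.
  apply: le_trans (ler_normD _ _) _; rewrite normrM mulrDr lerD//.
  by rewrite mulrCA ler_pM.
rewrite (_ : _ - b = expR a * (sin b - b) + (expR a - 1) * b); last ring.
apply: le_trans (ler_normD _ _) _; rewrite !normrM.
have -> : r * (5 * `|b|) = 3 * (r * `|b|) + 2 * r * `|b| by ring.
rewrite lerD//; first by rewrite ler_pM.
rewrite ler_wpM2r//; apply: le_trans E1 _; lra.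
Qed.

Lemma normC_le_ReIm (z : C) : `|z| <= (`|complex.Re z| + `|complex.Im z|)%:C%C.
Proof.
case: z => a b; rewrite normc_def lecR /=.
rewrite -[leRHS]ger0_norm ?addr_ge0// -sqrtr_sqr ler_wsqrtr//.
rewrite -(real_normK (num_real a)) -(real_normK (num_real b)).
by have := normr_ge0 a; have := normr_ge0 b; nra.
Qed.

Lemma normC_ge_ReIm (z : C) :
  (`|complex.Re z|)%:C%C <= `|z| /\ (`|complex.Im z|)%:C%C <= `|z|.
Proof.
case: z => a b; rewrite normc_def !lecR /= -!sqrtr_sqr.
by split; apply: ler_wsqrtr; [rewrite lerDl|rewrite lerDr]; exact: sqr_ge0.
Qed.

Lemma is_derive_expC0 : is_derive (0 : C) (1 : C) (@expC R : C -> C) 1.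
Proof.
apply: is_derive_normP => e e0.
(* A positive element of R[i] is real. *)
have [r rE] : exists r : R, e = r%:C%C.
  case: e e0 => r i; rewrite ltcE /= => /andP[/eqP -> _].
  by exists r.
move: e0; rewrite rE ltcR => r0.
(* The two bounds add up to s (|a| + 3|b| + 5|b|), at most 9 s |h|. *)
pose s := Num.min 1 (r / 9%:R).
have s0 : 0 < s by rewrite lt_min ltr01 divr_gt0.
have s1 : s <= 1 by rewrite ge_min lexx.
have [d d0 dP] := expR_cos_sin_linear_approx s s0 s1.
exists d%:C%C; first by rewrite ltcR.
move=> h _ hd; rewrite addr0 expC0 mul1r.
have [ha hb] := normC_ge_ReIm h.
have /dP /(_ _) P : `|complex.Re h| < d by rewrite -ltcR (le_lt_trans ha).
have /P[P1 P2] : `|complex.Im h| < d by rewrite -ltcR (le_lt_trans hb).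
apply: le_trans (normC_le_ReIm _) _.
have Q1 : complex.Re (expC h - 1 - h) =
    expR (complex.Re h) * cos (complex.Im h) - 1 - complex.Re h.
  by case: (h) => a b /=; rewrite mul0r subr0.
have Q2 : complex.Im (expC h - 1 - h) =
    expR (complex.Re h) * sin (complex.Im h) - complex.Im h.
  by case: (h) => a b /=; rewrite mul0r addr0 subr0.
rewrite Q1 Q2.
have sr : s * 9%:R <= r by rewrite -ler_pdivlMr// ge_min lexx orbT.
move: ha hb; rewrite normc_def -[r%:C%C * _]rmorphM !lecR => ha hb.
set N := Num.sqrt _ in ha hb *.
apply: (le_trans (lerD P1 P2)).
rewrite -mulrDr; apply: (@le_trans _ _ (s * (9%:R * N))); last first.
  by rewrite mulrA ler_wpM2r// sqrtr_ge0.
rewrite ler_pM2l//; lra.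
Qed.

Lemma is_derive_expC (z : C) : is_derive z (1 : C) (@expC R : C -> C) (expC z).
Proof. exact: is_derive_exponential expCD is_derive_expC0 z. Qed.

End ComplexExponential.

(** * The resonance polynomial and its stability *)

Definition resonance_poly (F : comNzRingType) (l : nat) (c : F) : {poly F} :=
  'X^2 * bessel F l + c *: (l.+1%:R *: bessel F l + 'X * cobessel F l).

Lemma horner_resonance_poly (F : comNzRingType) l (c w : F) :
  (resonance_poly F l c).[w] =
  w ^+ 2 * (bessel F l).[w] + c * (l.+1%:R * (bessel F l).[w] + w * (cobessel F l).[w]).
Proof.
rewrite /resonance_poly hornerD hornerM hornerXn hornerZ hornerD hornerZ.
by rewrite hornerM hornerX.
Qed.

Lemma resonance_poly_monic_size (F : comNzRingType) l (c : F) :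
  resonance_poly F l c \is monic /\ size (resonance_poly F l c) = l.+3.
Proof.
have mX : 'X^2 * bessel F l \is monic by rewrite monicMl ?monicXn ?bessel_monic.
have sX : size ('X^2 * bessel F l) = l.+3.
  by rewrite size_monicM ?monicXn ?size_polyXn ?size_bessel// monic_neq0// bessel_monic.
have lt : (size (c *: (l.+1%:R *: bessel F l + 'X * cobessel F l)) <
           size ('X^2 * bessel F l)%R)%N.
  rewrite sX ltnS (leq_trans (size_scale_leq _ _))//.
  rewrite (leq_trans (size_polyD _ _))// geq_max.
  rewrite (leq_trans (size_scale_leq _ _)) ?size_bessel//=.
  by rewrite (leq_trans (size_polyMleq _ _))// size_polyX size_cobessel.
split; last by rewrite /resonance_poly size_polyDl.
by apply/monicP; rewrite /resonance_poly lead_coefDl// (monicP mX).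
Qed.

(** Applied to complex conjugation, this shows that the polynomial is self-conjugate for real c. *)
Lemma map_resonance_poly (F K : comNzRingType) (f : {rmorphism F -> K}) l (c : F) :
  map_poly f (resonance_poly F l c) = resonance_poly K l (f c).
Proof.
have [ft fr] := map_bessel F K f l.
rewrite /resonance_poly rmorphD rmorphM /= linearZ /= rmorphD rmorphM /= linearZ /=.
by rewrite map_polyXn map_polyX ft fr rmorph_nat.
Qed.

(** Clearing denominators creates no spurious root: P(0) = c (l+1) theta_l(0), and P(w) = c w
    rho_l(w) at a zero w of theta_l, both nonzero. *)
Lemma resonance_root_bessel (F : numFieldType) l (c w : F) : c != 0 ->
  root (resonance_poly F l c) w -> w != 0 /\ (bessel F l).[w] != 0.
Proof.
move=> c0; rewrite /root horner_resonance_poly => Pw.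
have w0 : w != 0.
  apply/eqP => w0; move: Pw; rewrite w0 expr0n /= !mul0r add0r addr0.
  by rewrite !mulf_eq0 (negPf c0) pnatr_eq0 (negPf (bessel_nonroot0 F l)).
split=> //; apply/eqP => t0; move: Pw; rewrite t0 !mulr0 !add0r.
by rewrite !mulf_eq0 (negPf c0) (negPf w0) (negPf (bessel_cobessel_coprime F l w w0 t0)).
Qed.

Section Stability.
Variable R : realType.
Local Notation C := (Cplx R).
Local Notation theta := (bessel C).
Local Notation rho := (cobessel C).

Lemma ReD (z w : C) : complex.Re (z + w) = complex.Re z + complex.Re w.
Proof. by case: z w => [a b] [c d]. Qed.

Lemma ReZ (r : R) (z : C) : complex.Re (r%:C%C * z) = r * complex.Re z.
Proof. by case: z => a b /=; rewrite mul0r subr0. Qed.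

Lemma ImZ (r : R) (z : C) : complex.Im (r%:C%C * z) = r * complex.Im z.
Proof. by case: z => a b /=; rewrite mul0r addr0. Qed.

Lemma ReV_ge0 (z : C) : 0 <= complex.Re z -> 0 <= complex.Re z^-1.
Proof.
by case: z => a b /= a0; rewrite divr_ge0// addr_ge0// sqr_ge0.
Qed.

Lemma ReV_gt0 (z : C) : 0 < complex.Re z -> 0 < complex.Re z^-1.
Proof.
by case: z => a b /= a0; rewrite divr_gt0// ltr_pwDl ?sqr_ge0// exprn_gt0.
Qed.

Lemma Re_neq0 (z : C) : 0 < complex.Re z -> z != 0.
Proof. by move=> z0; apply/eqP => zE; move: z0; rewrite zE ltxx. Qed.

(** Both claims share one induction: theta_(n+1)(w) = w theta_n(w) s with Re s > 0, so it is
    nonzero, and the next ratio is 1/s. *)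
Lemma bessel_ratio_Re_gt0 n (w : C) : w != 0 -> 0 <= complex.Re w ->
  (theta n).[w] != 0 /\ 0 < complex.Re ((rho n).[w] / (theta n).[w]).
Proof.
move=> w0 wR; elim: n => [|n [t0 IH]].
  by rewrite bessel0 cobessel0 !hornerC divr1 oner_neq0 ltr01.
set s := (2 * n + 1)%:R%:C%C * w^-1 + (rho n).[w] / (theta n).[w].
have s0 : 0 < complex.Re s.
  by rewrite ReD ReZ ltr_wpDl// mulr_ge0 ?ReV_ge0// ler0n.
have sn0 := Re_neq0 _ s0.
have tE : (theta n.+1).[w] = w * (theta n).[w] * s.
  rewrite besselS hornerD hornerZ hornerM hornerX /s rmorph_nat.
  by field; rewrite w0 t0.
split; first by rewrite tE !mulf_neq0.
rewrite cobesselS hornerM hornerX tE.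
have -> : w * (theta n).[w] / (w * (theta n).[w] * s) = s^-1.
  by field; rewrite w0 t0 sn0.
exact: ReV_gt0.
Qed.

Lemma resonance_root_Re_lt0 l (c : R) (w : C) : 0 < c ->
  root (resonance_poly C l c%:C%C) w -> complex.Re w < 0.
Proof.
move=> c0 rw; rewrite ltNge; apply/negP => wR.
have [w0 t0] : w != 0 /\ (theta l).[w] != 0.
  by apply: resonance_root_bessel rw; rewrite (inj_eq (@complexI _)) gt_eqF.
have [_ rt] := bessel_ratio_Re_gt0 l w w0 wR.
(* This is P(w) / (w theta_l(w)). Its last summand has strictly positive real part, which also
   excludes the imaginary axis. *)
set s := w + (c * l.+1%:R)%:C%C * w^-1 + c%:C%C * ((rho l).[w] / (theta l).[w]).
have /Re_neq0/eqP : 0 < complex.Re s.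
  rewrite !ReD !ReZ ltr_wpDl ?mulr_gt0// addr_ge0// mulr_ge0 ?ReV_ge0//.
  by rewrite mulr_ge0 ?ler0n// ltW.
apply; move: rw; rewrite /root horner_resonance_poly => /eqP P0.
apply: (mulfI (mulf_neq0 w0 t0)); rewrite mulr0 -{}P0 /s rmorphM rmorph_nat.
by field; rewrite w0 t0.
Qed.

End Stability.

(** * Spherical Hankel functions *)

(** Since theta_n' = theta_n - rho_n, the term -theta_n from differentiating E(-x) cancels and only
    rho_n survives. *)
Lemma is_derive_exp_bessel (K : numFieldType) (E : K -> K) n (w : K) :
  (forall z, is_derive z (1 : K) E (E z)) -> w != 0 ->
  is_derive w (1 : K) (fun x => E (- x) * (x^-1 ^+ n.+1 * (bessel K n).[x]))
    (- (E (- w) * w^-1 ^+ n.+2 *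
        (n.+1%:R * (bessel K n).[w] + w * (cobessel K n).[w]))).
Proof.
move=> dE w0.
have d1 : is_derive w (1 : K) (E \o -%R) (E (- w) * -1).
  exact: is_derive_comp.
have d2 : is_derive w (1 : K) (fun x : K => x^-1) (- w ^- 2).
  split; first exact: derivableV.
  by rewrite deriveV// derive_id /GRing.scale /= mulr1.
have d3 : is_derive w (1 : K) ((fun x : K => x^-1) ^+ n.+1)
    ((n.+1%:R * w^-1 ^+ n) *: (- w ^- 2)).
  exact: is_deriveX.
have d4 := is_derive_horner K (bessel K n) w.
rewrite (_ : (fun x => _) =
  (E \o -%R) * ((fun x : K => x^-1) ^+ n.+1 * horner (bessel K n))); last first.
  by apply/funext => x; rewrite !fctE.
apply: is_derive_eq.
rewrite deriv_bessel hornerD hornerN !fctE /GRing.scale /= !exprS.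
by field.
Qed.

Section Hankel.
Variable R : realType.
Local Notation C := (Cplx R).
Local Notation theta := (bessel C).
Local Notation rho := (cobessel C).

Lemma hankel1E l (z : C) : z != 0 ->
  hankel1 l z = (- 'i) ^+ l.+2 *
    (expC (- (- 'i * z)) * ((- 'i * z)^-1 ^+ l.+1 * (theta l).[- 'i * z])).
Proof.
move=> z0; have i0 : 'i != 0 :> C by exact: neq0Ci.
have w0 : - 'i * z != 0 by rewrite mulf_neq0 ?oppr_eq0.
rewrite horner_bessel// /hankel1.
set S := \sum_(k < l.+1) _; set S' := \sum_(k < l.+1) _.
have -> : S = S'.
  apply: eq_bigr => k _; rewrite /bessel_coef -ltnS ltn_ord; congr (_ * _ ^+ _).
  by rewrite -invCi; field; rewrite z0 i0.
have -> : - (- 'i * z) = 'i * z by rewrite mulNr opprK.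
rewrite (exprSr _ l.+1) (exprSr _ l) -!mulrA; congr (_ * _).
(* With w = -iz, 1/z = -i/w supplies the additional factor -i in the power l+2. *)
rewrite (_ : z^-1 = - 'i * (- 'i * z)^-1); last by field; rewrite z0 i0.
move: (- 'i * z) w0 => w w0; rewrite (exprSr _ l) exprVn.
by field; rewrite w0 expf_neq0.
Qed.

Lemma hankel1_neq0 l (z : C) :
  (hankel1 l z != 0) = (z != 0) && ((theta l).[- 'i * z] != 0).
Proof.
(* The convention 0^-1 = 0 gives [hankel1 l 0] the value 0, so the origin falls outside the
   domain. *)
have [->|z0] /= := eqVneq z 0; first by rewrite /hankel1 invr0 mulr0 mul0r eqxx.
have w0 : - 'i * z != 0 by rewrite mulf_neq0 ?oppr_eq0 ?neq0Ci.
rewrite hankel1E// mulrA mulrA mulf_eq0 negb_or andb_idl// => _.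
apply: mulf_neq0; last by rewrite expf_neq0// invr_eq0.
apply: mulf_neq0; last exact: expC_neq0.
by rewrite expf_neq0// oppr_eq0 neq0Ci.
Qed.

Lemma G_lE l (z : C) : hankel1 l z != 0 ->
  G_l l z = - (l.+1%:R + - 'i * z * ((rho l).[- 'i * z] / (theta l).[- 'i * z])).
Proof.
move=> hz; have := hz; rewrite hankel1_neq0 => /andP[z0 t0].
have i0 : 'i != 0 :> C by exact: neq0Ci.
have w0 : - 'i * z != 0 by rewrite mulf_neq0 ?oppr_eq0.
have dE := is_derive_exp_bessel C (@expC R) l _ (is_derive_expC R) w0.
set d := - (_ * _) in dE.
have dl : is_derive z (1 : C) (fun x : C => - 'i * x) (- 'i).
  have := is_deriveZ (- 'i : C) (is_derive_id z (1 : C)).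
  by rewrite /GRing.scale /= mulr1.
have dc := is_derive_comp C _ _ z _ _ dE dl.
have dh : is_derive z (1 : C) (hankel1 l : C -> C) ((- 'i) ^+ l.+2 * (d * - 'i)).
  have := is_deriveZ ((- 'i) ^+ l.+2 : C) dc.
  (* The formula [hankel1E] holds only off 0, so the derivative is transferred through equality near
     z. *)
  apply: near_eq_is_derive.
  near=> x; rewrite hankel1E//.
  by near: x; exact: cvgr_neq0 (@cvg_id _ _) z0.
rewrite /G_l derive1E (@derive_val _ _ _ _ _ _ _ dh) hankel1E// /d.
have e0 := expC_neq0 R (- (- 'i * z)).
have p0 : (- 'i) ^+ l.+2 != 0 :> C by rewrite expf_neq0 // oppr_eq0.
have q0 : (- 'i * z)^-1 ^+ l.+1 != 0 by rewrite expf_neq0// invr_eq0.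
(* The prefactor z and the chain-rule factor -i combine into w = -iz. *)
have commz (p e : C) : z * (p * (e * - 'i)) = p * (e * (- 'i * z)) by ring.
rewrite commz [(_ * z)^-1 ^+ l.+2]exprS.
move: (expC _) e0 (_ ^+ l.+2) p0 (_ ^+ l.+1) q0 => e e0 p p0 q q0.
move: (- 'i * z) w0 t0 => w w0 t0.
by field; rewrite w0 t0 e0 p0 q0.
Unshelve. all: by end_near.
Qed.

End Hankel.

(** * From roots of the polynomial to resonances *)

(** The roots of a self-conjugate p are closed under conjugation, and for real a, -conj(i r / a) = i
    conj(r) / a. *)
Lemma rotated_roots_symmetric (C : numClosedFieldType) (p : {poly C}) (a : C) rs :
  map_poly (Num.conj : C -> C) p = p -> a \is Num.real ->
  p = \prod_(r <- rs) ('X - r%:P) ->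
  forall mu, mu \in [seq 'i * r / a | r <- rs] ->
  - Num.conj mu \in [seq 'i * r / a | r <- rs].
Proof.
move=> cp ar pE mu /mapP[r rrs ->].
apply/mapP; exists (Num.conj r); last first.
  by rewrite !rmorphM /= fmorphV /= conjCi (CrealP ar) !mulNr opprK.
rewrite -root_prod_XsubC -pE /root -[p in p.[_]]cp horner_map.
by rewrite fmorph_eq0 -/(root p r) pE root_prod_XsubC.
Qed.

Lemma continuous_div_horner (K : numFieldType) (p : {poly K}) (c z : K) :
  p.[z] != 0 -> {for z, continuous (fun x : K => c / p.[x])}.
Proof.
move=> pz; apply: (continuousM (@cst_continuous _ _ c z)).
exact: continuousV pz (continuous_horner_numField K p z).
Qed.

(** The mode l = 1 is excluded because its factor l - 1 vanishes; for l = 0, gamma > 1 makes 3 gamma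
    - 1 positive. *)
Lemma rhat_gt0 (R : realType) (Ca We gamma : R) l :
  0 < Ca -> 0 < We -> 1 < gamma -> l != 1%N -> 0 < rhat Ca We gamma l.
Proof.
move=> Ca0 We0 g1; rewrite /rhat; case: ifP => [_ _|]; last first.
  by case: l => [|[|l]]// _ _; rewrite divr_gt0// ltr0n muln_gt0.
by rewrite addr_gt0// ?(divr_gt0, mulr_gt0)//; lra.
Qed.

Theorem theorem6p1 (R : realType) (Ca We gamma eps : R) :
  0 < Ca -> 0 < We -> 1 < gamma -> 0 < eps ->
  forall l : nat, l != 1%N ->
  let D := fun lam : Cplx R => hankel1 l ((eps%:C)%C * lam) != 0 in
  let F := fun lam : Cplx R =>
    lam ^+ 2 + ((rhat Ca We gamma l)%:C)%C * G_l l ((eps%:C)%C * lam) in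
  exists s : seq (Cplx R),
    [/\ size s = l.+2,
        (* (i) the solutions, with multiplicity: s lies in the domain and
           F = prod_{mu in s} (lam - mu) * g with g continuous and zero-free on the domain *)
        (forall mu, mu \in s -> D mu),
        (exists g : Cplx R -> Cplx R,
           forall lam, D lam ->
             [/\ {for lam, continuous g}, g lam != 0 &
                 F lam = (\prod_(mu <- s) (lam - mu)) * g lam]),
        (* (ii) symmetry about the imaginary axis *)
        (forall mu, mu \in s -> - Num.conj mu \in s) &
        (* (ii) all resonances lie in the lower half plane *)
        (forall mu, mu \in s -> complex.Im mu < 0)].
Proof.
move=> Ca0 We0 g1 e0 l l1 D F.
have r0 := rhat_gt0 R Ca We gamma l Ca0 We0 g1 l1.
set r := rhat _ _ _ _ in r0 F *.
pose C := Cplx R; pose a : C := eps%:C%C; pose c : R := r * eps ^+ 2.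
have c0 : 0 < c by rewrite mulr_gt0// exprn_gt0.
have a0 : a != 0 by rewrite (inj_eq (@complexI _)) gt_eqF.
have i0 : 'i != 0 :> C by exact: neq0Ci.
have [mp sp] := resonance_poly_monic_size C l c%:C%C.
set p := resonance_poly C l _ in mp sp.
have [rs] := closed_field_poly_normal p; rewrite (monicP mp) scale1r => pE.
have rsroot w : w \in rs -> root p w by rewrite pE root_prod_XsubC.
have srs : size rs = l.+2.
  by apply/eqP; rewrite -eqSS -(size_prod_XsubC rs id) -pE sp.
have wE (w : C) : - 'i * (a * ('i * w / a)) = w.
  rewrite (_ : - 'i * _ = - ('i ^+ 2) * w); last by field.
  by rewrite sqrCi opprK mul1r.
have lamE (lam : C) : 'i * (- 'i * (a * lam)) / a = lam.
  rewrite (_ : _ / a = - ('i ^+ 2) * lam); last by field.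
  by rewrite sqrCi opprK mul1r.
(* The substitution w = -i a lam is inverted on the list of roots, multiplicities included. *)
exists [seq 'i * w / a | w <- rs]; split.
- by rewrite size_map.
- move=> _ /mapP[w /rsroot rw ->]; rewrite /D hankel1_neq0 wE.
  have [|w0 ->] := resonance_root_bessel C l c%:C%C w _ rw.
    by rewrite (inj_eq (@complexI _)) gt_eqF.
  by rewrite andbT !mulf_neq0// invr_eq0.
(* Here -a^-2 comes from F = -a^-2 P(w) / theta_l(w), and (a/i)^(l+2) from w - w_j = (a/i)(lam -
   mu_j) in each of the l+2 factors of P. *)
- pose k : C := - (a ^+ 2)^-1 * (a / 'i) ^+ l.+2.
  pose q : {poly C} := bessel C l \Po ((- 'i * a) *: 'X).
  have qE x : q.[x] = (bessel C l).[- 'i * (a * x)].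
    by rewrite /q horner_comp hornerZ hornerX mulrA.
  exists (fun x : C => k / q.[x]) => lam Dlam.
  have := Dlam; rewrite /D hankel1_neq0 => /andP[al0 t0].
  have k0 : k != 0.
    by rewrite mulf_neq0 ?oppr_eq0 ?invr_eq0 ?expf_neq0// mulf_neq0// invr_eq0.
  split.
  + by apply: continuous_div_horner; rewrite qE.
  + by rewrite mulf_neq0// invr_eq0 qE.
  rewrite /F G_lE//.
  have -> : \prod_(mu <- [seq 'i * w / a | w <- rs]) (lam - mu) =
      ('i / a) ^+ l.+2 * p.[- 'i * (a * lam)].
    rewrite big_map pE horner_prod -srs.
    elim: (rs) => [|w s IH]; first by rewrite !big_nil mul1r.
    rewrite !big_cons IH hornerXsubC /= exprS -{1}[lam]lamE.
    by field.
  have scale1 : ('i / a) ^+ l.+2 * (a / 'i) ^+ l.+2 = 1.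
    by rewrite -exprMn mulrA divfK// divff// expr1n.
  rewrite qE horner_resonance_poly /k /c rmorphM rmorphXn /= -/a -{1}[lam]lamE.
  move: (_ ^+ l.+2) (_ ^+ l.+2) scale1 => u v uv.
  move: (- 'i * (a * lam)) t0 => w t0.
  rewrite [RHS](_ : _ = v * u * - (a ^+ 2)^-1 * (w ^+ 2 + r%:C%C * a ^+ 2 *
    (l.+1%:R + w * ((cobessel C l).[w] / (bessel C l).[w])))); last first.
    by field; rewrite t0 a0.
  by rewrite uv !exprMn sqrCi; field; rewrite t0 a0.
- apply: (rotated_roots_symmetric _ p) => //.
  + rewrite map_resonance_poly; congr resonance_poly; apply/CrealP.
    by rewrite complex_real.
  + by rewrite complex_real.
- move=> _ /mapP[w /rsroot rw ->].
  have := resonance_root_Re_lt0 R l c w c0 rw.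
  (* The rotation turns Re w into Im lam, up to the positive factor 1/eps. *)
  have -> : 'i * w / a = (eps^-1)%:C%C * (w * 'i%C).
    by rewrite complexiE fmorphV mulrC [w * _]mulrC.
  by rewrite ImZ ImiRe pmulr_rlt0// invr_gt0.
Qed.
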